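(* Given a finite PTI net $N=(S,A,T,I)$, for each pair of markings $m_1,m_2\in\mathcal{M}(S)$ it is decidable whether $m_1\sim_p m_2$; i.e., there is an algorithm that, given $N$, $m_1$ and $m_2$, decides whether $m_1$ and $m_2$ are pti-place bisimilar.
   Context: Multisets over a finite set $S$ are functions $m:S\to\mathbb{N}$; $\mathcal{M}(S)$ is their set, $\theta$ the empty multiset, $\subseteq$ pointwise order, $\oplus$ pointwise sum, $(m\ominus m')(s)=\max\{m(s)-m'(s),0\}$, $\mathit{dom}(m)=\{s\mid m(s)\ne0\}$; a place $s$ also denotes the singleton multiset. A finite PTI net is $N=(S,A,T,I)$ with finite places $S$, finite labels $A$, finite transitions $T\subseteq(\mathcal{M}(S)\setminus\{\theta\})\times A\times(\mathcal{M}(S)\setminus\{\theta\})$ and inhibiting relation $I\subseteq S\times T$. For $t=(m,\ell,m')$: ${}^\bullet t=m$, $l(t)=\ell$, $t^\bullet=m'$, ${}^\circ t=\{s\mid(s,t)\in I\}$. $t$ is enabled at marking $m$ if ${}^\bullet t\subseteq m$ and ${}^\circ t\cap\mathit{dom}(m)=\emptyset$, and then $m[t\rangle m'$ with $m'=(m\ominus{}^\bullet t)\oplus t^\bullet$. For $R\subseteq S\times S$, $R^\oplus$ is the least relation on $\mathcal{M}(S)$ with $(\theta,\theta)\in R^\oplus$ and $(s_1\oplus m_1,s_2\oplus m_2)\in R^\oplus$ whenever $(s_1,s_2)\in R$ and $(m_1,m_2)\in R^\oplus$. $R$ is a pti-place bisimulation if whenever $(m_1,m_2)\in R^\oplus$: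 (1) for every $t_1$ with $m_1[t_1\rangle m_1'$ there is $t_2$ with $m_2[t_2\rangle m_2'$ such that (a) $({}^\bullet t_1,{}^\bullet t_2)\in R^\oplus$, $(t_1^\bullet,t_2^\bullet)\in R^\oplus$, $l(t_1)=l(t_2)$, $(m_1\ominus{}^\bullet t_1,m_2\ominus{}^\bullet t_2)\in R^\oplus$, and (b) for all $(s,s')\in R$, $s\in{}^\circ t_1\iff s'\in{}^\circ t_2$; (2) symmetrically, for every $t_2$ with $m_2[t_2\rangle m_2'$ there is $t_1$ with $m_1[t_1\rangle m_1'$ satisfying (a) and (b). Markings are pti-place bisimilar, $m_1\sim_p m_2$, if there exists a pti-place bisimulation $R$ with $(m_1,m_2)\in R^\oplus$. *)

(* Defs.v *)
From HB Require Import structures.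
From mathcomp Require Import all_boot finmap.

Set Implicit Arguments.
Unset Strict Implicit.
Unset Printing Implicit Defensive.

Notation marking S := {ffun S -> nat}.

Section Multisets.
Variable S : finType.
Implicit Types (m : marking S) (s : S) (R : {set S * S}).

Definition theta : marking S := [ffun=> 0].
Definition msing s : marking S := [ffun s' => (s' == s : nat)].
Definition msub m m' : Prop := forall s, m s <= m' s.
Definition madd m m' : marking S := [ffun s => m s + m' s].
Definition mdiff m m' : marking S := [ffun s => m s - m' s].
Definition mdom m : {set S} := [set s | m s != 0].

Inductive add_closure R : marking S -> marking S -> Prop :=
| add_closure0 : add_closure R theta theta
| add_closureD s1 s2 m1 m2 :
    (s1, s2) \in R -> add_closure R m1 m2 ->
    add_closure R (madd (msing s1) m1) (madd (msing s2) m2).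

End Multisets.

Arguments theta {S}.

Record pti_net := PTINet {
  place : finType;
  label : finType;
  trans : {fset marking place * label * marking place};
  trans_pre_neq0 : forall t, t \in trans -> t.1.1 <> theta;
  trans_post_neq0 : forall t, t \in trans -> t.2 <> theta;
  inhibiting : {set place * trans}
}.

Section Nets.
Variable N : pti_net.
Implicit Types (t : trans N) (m : marking (place N)).

Definition pre t : marking (place N) := (val t).1.1.
Definition lab t : label N := (val t).1.2.
Definition post t : marking (place N) := (val t).2.
Definition inh t : {set place N} := [set s | (s, t) \in inhibiting N].

Definition enabled t m : Prop := msub (pre t) m /\ inh t :&: mdom m = set0.

Definition fires m t m' : Prop :=
  enabled t m /\ m' = madd (mdiff m (pre t)) (post t).

Definition matching (R : {set place N * place N}) m1 t1 m2 t2 : Prop :=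
  [/\ add_closure R (pre t1) (pre t2),
      add_closure R (post t1) (post t2),
      lab t1 = lab t2,
      add_closure R (mdiff m1 (pre t1)) (mdiff m2 (pre t2)) &
      forall s s', (s, s') \in R -> (s \in inh t1 <-> s' \in inh t2)].

Definition pti_place_bisimulation (R : {set place N * place N}) : Prop :=
  forall m1 m2, add_closure R m1 m2 ->
    (forall t1 m1', fires m1 t1 m1' ->
       exists t2 m2', fires m2 t2 m2' /\ matching R m1 t1 m2 t2) /\
    (forall t2 m2', fires m2 t2 m2' ->
       exists t1 m1', fires m1 t1 m1' /\ matching R m1 t1 m2 t2).

Definition pti_place_bisimilar m1 m2 : Prop :=
  exists R, pti_place_bisimulation R /\ add_closure R m1 m2.

End Nets.

(* Under excluded middle and choice, every predicate has a [bool]-valued decision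
   function, so decidability is stated with partial recursive (mu-recursive)
   functions: [recfun n] is their syntax at arity [n], and [eval f xs y] means
   that [f] halts on [xs] with result [y].  [PrimRec] recurses on the first
   argument. *)

Inductive recfun : nat -> Type :=
| Zero n : recfun n
| Succ : recfun 1
| Proj n (i : 'I_n) : recfun n
| Comp k n (f : recfun k) (g : 'I_k -> recfun n) : recfun n
| PrimRec n (f : recfun n) (g : recfun n.+2) : recfun n.+1
| Mu n (f : recfun n.+1) : recfun n.

Fixpoint eval n (f : recfun n) : n.-tuple nat -> nat -> Prop :=
  match f in recfun n return n.-tuple nat -> nat -> Prop with
  | Zero _ => fun _ y => y = 0
  | Succ => fun xs y => y = (thead xs).+1
  | Proj _ i => fun xs y => y = tnth xs i
  | Comp k _ f g => fun xs y =>
      exists zs : k.-tuple nat,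
        (forall i, eval (g i) xs (tnth zs i)) /\ eval f zs y
  | PrimRec _ f g => fun xs y =>
      let ps := behead_tuple xs in
      (fix rec (m y : nat) : Prop :=
         if m is m'.+1 then
           exists z, rec m' z /\ eval g [tuple of m' :: z :: ps] y
         else eval f ps y) (thead xs) y
  | Mu _ f => fun xs y =>
      eval f [tuple of y :: xs] 0 /\
      forall k, k < y -> exists z, eval f [tuple of k :: xs] z.+1
  end.

Lemma eval_functional n (f : recfun n) xs y y' :
  eval f xs y -> eval f xs y' -> y = y'.
Proof.
elim: f xs y y' => {n} [n|||k n f IHf g IHg|n f IHf g IHg|n f IHf] xs y y' /=.
- by move=> -> ->.
- by move=> -> ->.
- by move=> n i -> ->.
- move=> [zs [gz fz]] [zs' [gz' fz']].
  suff eq_zs : zs = zs' by subst zs'; apply: IHf fz fz'.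
  by apply: eq_from_tnth => i; apply: IHg (gz i) (gz' i).
- elim: (thead xs) y y' => [|m IHm] y y'; first exact: IHf.
  by move=> [z [rz gz]] [z' [/(IHm _ _ rz) <- gz']]; apply: IHg gz gz'.
move=> [f0 fS] [f0' fS']; case: (ltngtP y y') => // lt_yy.
- by have [z fz] := fS' _ lt_yy; have := IHf _ _ _ f0 fz.
- by have [z fz] := fS _ lt_yy; have := IHf _ _ _ f0' fz.
Qed.

(* [CodeSeq.code] is the bijection [seq nat -> nat] given by
   [code [::] = 0] and [code (n :: s) = 2 ^ n * (2 * code s + 1)].  An instance
   is coded relative to arbitrary listings [eS], [eA], [eT] of the places,
   labels and transitions: markings and sets of places become sequences indexed
   by [eS], and labels become their positions in [eA]. *)

Section Coding.
Variable N : pti_net.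
Variables (eS : seq (place N)) (eA : seq (label N)) (eT : seq (trans N)).

Definition code_marking (m : marking (place N)) : nat :=
  CodeSeq.code [seq m s | s <- eS].

Definition code_places (X : {set place N}) : nat :=
  CodeSeq.code [seq (s \in X : nat) | s <- eS].

Definition code_trans (t : trans N) : nat :=
  CodeSeq.code [:: code_marking (pre t); index (lab t) eA;
                   code_marking (post t); code_places (inh t)].

Definition code_net : nat :=
  CodeSeq.code [:: size eS; size eA; CodeSeq.code [seq code_trans t | t <- eT]].

Definition code_instance (m1 m2 : marking (place N)) : nat :=
  CodeSeq.code [:: code_net; code_marking m1; code_marking m2].

End Coding.

Definition instance_code (N : pti_net) (m1 m2 : marking (place N)) (c : nat) :
    Prop :=
  exists (eS : seq (place N)) (eA : seq (label N)) (eT : seq (trans N)),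
    [/\ Finite.axiom eS, Finite.axiom eA, Finite.axiom eT &
        c = code_instance eS eA eT m1 m2].

(* Main.v *)
(** A marking [m1] is related to [m2] by the additive closure of [R] iff there
    is a nonnegative integer matrix supported on [R] with row sums [m1]
    and column sums [m2]. Such a matrix can be split along any [p] below
    [m1], and condition (b) makes the inhibitor test transfer along [R];
    hence it suffices to check the bisimulation condition at the markings
    [m1 = pre t1], where the partner transition must consume exactly [m2].
    The candidates [m2] then have entries bounded by the size of [pre t1],
    so that bisimilarity is an arithmetic formula all of whose quantifiers
    are bounded by an explicit function of the code of the instance; such
    formulas are evaluated by primitive recursion. *)

Require Import Defs.
From mathcomp Require Import all_boot finmap.
From mathcomp Require Import zify.

Set Implicit Arguments.
Unset Strict Implicit.
Unset Printing Implicit Defensive.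

(** * Additive closure and transport plans *)

Section AdditiveClosure.
Variable S : finType.
Implicit Types (m p q : marking S) (R : {set S * S}) (s : S).

(** [W s s'] counts how often the pair [(s, s')] is used in a derivation of the closure. *)
Definition transport_plan R m1 m2 (W : S -> S -> nat) : Prop :=
  [/\ forall s s', W s s' != 0 -> (s, s') \in R,
      forall s, \sum_s' W s s' = m1 s & forall s', \sum_s W s s' = m2 s'].

Lemma add_closure_plan R m1 m2 :
  add_closure R m1 m2 -> exists W, transport_plan R m1 m2 W.
Proof.
elim=> [|s1 s2 {}m1 {}m2 Rs _ [W [supp row col]]].
  by exists (fun _ _ => 0); split=> // s; rewrite ffunE big1.
exists (fun s s' => ((s == s1) && (s' == s2)) + W s s'); split.
- move=> s s'; case: (s =P s1) => [->|_] /=; last exact: supp.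
  by case: (s' =P s2) => [->|_] //=; apply: supp.
- move=> s; rewrite big_split /= row !ffunE; congr (_ + _).
  case: eqP => _; last by rewrite big1.
  by rewrite (bigD1 s2) //= eqxx big1 // => s' /negPf ->.
- move=> s'; rewrite big_split /= col !ffunE; congr (_ + _).
  case: eqP => _; last by rewrite big1 // => s; rewrite andbF.
  by rewrite (bigD1 s1) //= eqxx big1 // => s /negPf ->.
Qed.

(** Induction on the total mass [k] of the plan. Lowering a nonzero entry at [(a, b)] by one, which
    subtracts the unit matrix [d], peels off one application of [add_closureD]. *)
Lemma plan_add_closure R m1 m2 W : transport_plan R m1 m2 W ->
  add_closure R m1 m2.
Proof.
move Ek: (\sum_s \sum_s' W s s') => k.
elim: k W m1 m2 Ek => [|k IHk] W m1 m2 Ek [supp row col].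
  have W0 s s' : W s s' = 0.
    by apply/eqP; move/eqP: Ek; rewrite sum_nat_eq0 => /forallP/(_ s)/=;
       rewrite sum_nat_eq0 => /forallP/(_ s').
  have -> : m1 = theta by apply/ffunP=> s; rewrite -row ffunE big1.
  have -> : m2 = theta by apply/ffunP=> s; rewrite -col ffunE big1.
  exact: add_closure0.
have [[a b] /= Wab|W0] := pickP (fun p : S * S => W p.1 p.2 != 0); last first.
  by move: Ek; rewrite big1 // => s _; rewrite big1 // => s' _;
     apply/eqP/negbFE/(W0 (s, s')).
pose d s s' : nat := (s == a) && (s' == b).
pose W' s s' := W s s' - d s s'.
have WE s s' : W s s' = d s s' + W' s s'.
  by rewrite /W' /d; case: eqP => [->|_] /=; [case: eqP => [->|_] /=|]; lia.
have drow s : \sum_s' d s s' = (s == a).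
  rewrite /d; case: eqP => _; last by rewrite big1.
  by rewrite (bigD1 b) //= eqxx big1 // => s' /negPf ->.
have dcol s' : \sum_s d s s' = (s' == b).
  rewrite /d; case: eqP => _; last by rewrite big1 // => s; rewrite andbF.
  by rewrite (bigD1 a) //= eqxx big1 // => s /negPf ->.
pose r : marking S := [ffun s => \sum_s' W' s s'].
pose c : marking S := [ffun s' => \sum_s W' s s'].
have -> : m1 = madd (msing a) r.
  by apply/ffunP=> s; rewrite -row !ffunE -drow -big_split; apply: eq_bigr.
have -> : m2 = madd (msing b) c.
  by apply/ffunP=> s'; rewrite -col !ffunE -dcol -big_split; apply: eq_bigr.
apply: add_closureD; first exact: supp.
apply: (IHk W'); last first.
  split=> [s s'|s|s']; rewrite ?ffunE // => W'n0.
  by apply: supp; rewrite WE addn_eq0 negb_and W'n0 orbT.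
have : \sum_s \sum_s' W s s' = \sum_s (s == a) + \sum_s \sum_s' W' s s'.
  rewrite -big_split; apply: eq_bigr => s _; rewrite -drow -big_split.
  by apply: eq_bigr.
rewrite Ek (bigD1 a) //= eqxx big1 => [|s /negPf -> //].
by rewrite addn0 add1n => -[].
Qed.

Definition converse R : {set S * S} := [set p | (p.2, p.1) \in R].

Lemma converseK R : converse (converse R) = R.
Proof. by apply/setP=> -[s s']; rewrite !inE. Qed.

Lemma add_closure_converse R m1 m2 :
  add_closure R m1 m2 -> add_closure (converse R) m2 m1.
Proof.
elim=> [|s1 s2 {}m1 {}m2 Rs _ IH]; first exact: add_closure0.
by apply: add_closureD; rewrite ?inE.
Qed.

(** Each entry of column [s] of a plan is at most the sum of its row. This later bounds the markings
    among which a partner preset is sought. *)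
Lemma add_closure_le_sum R m1 m2 s :
  add_closure R m1 m2 -> m2 s <= \sum_s' m1 s'.
Proof.
case/add_closure_plan=> W [_ row <-]; apply: leq_sum => s' _.
by rewrite -row (bigD1 s) //= leq_addr.
Qed.

Lemma add_closure_theta R m : add_closure R theta m -> m = theta.
Proof.
move=> Rm; apply/ffunP=> s; apply/eqP; rewrite [theta s]ffunE -leqn0.
by apply: leq_trans (add_closure_le_sum s Rm) _; rewrite big1 // => s' _;
  rewrite ffunE.
Qed.

Lemma add_closure_dom R m1 m2 s' : add_closure R m1 m2 -> s' \in mdom m2 ->
  exists2 s, s \in mdom m1 & (s, s') \in R.
Proof.
case/add_closure_plan=> W [supp row col]; rewrite inE -col.
rewrite sum_nat_eq0 => /forallPn [s]; rewrite negb_imply /= => Wn0.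
exists s; last exact: supp.
by rewrite inE -row (bigD1 s') //= addn_eq0 negb_and Wn0.
Qed.

(** Induction on the derivation: each pair [(s1, s2)] is assigned either to the part matched with
    [p] or to the remainder. *)
Lemma add_closure_split R m1 m2 p : add_closure R m1 m2 -> msub p m1 ->
  exists q, [/\ add_closure R p q, msub q m2 &
                add_closure R (mdiff m1 p) (mdiff m2 q)].
Proof.
move=> Rm; elim: Rm p => [|s1 s2 {}m1 {}m2 Rs _ IH] p le_p.
  have -> : p = theta.
    by apply/ffunP=> s; have := le_p s; rewrite !ffunE leqn0 => /eqP.
  exists theta; split=> //; try exact: add_closure0.
  have -> : mdiff theta theta = theta :> marking S by apply/ffunP=> s;
    rewrite !ffunE.
  exact: add_closure0.
(* If [p] asks for more tokens on [s1] than [m1] still holds, the pair has to serve [p]; otherwise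
   [p] already fits below [m1] and the pair joins the remainder. *)
have [lt_p|ge_p] := ltnP (m1 s1) (p s1).
  pose p' := mdiff p (msing s1).
  have pE : p = madd (msing s1) p'.
    by apply/ffunP=> s; rewrite !ffunE; case: eqP => [->|_] /=; lia.
  have /IH [q' [Rpq le_q Rd]] : msub p' m1.
    by move=> s; have := le_p s; rewrite !ffunE; case: eqP => [->|_] /=; lia.
  exists (madd (msing s2) q'); split.
  - by rewrite pE; apply: add_closureD.
  - by move=> s; rewrite !ffunE leq_add2l.
  - have dE a (m m' : marking S) :
        mdiff (madd (msing a) m) (madd (msing a) m') = mdiff m m'.
      by apply/ffunP=> s; rewrite !ffunE subnDl.
    by rewrite pE !dE.
have le_p' : msub p m1.
  by move=> s; have := le_p s; rewrite !ffunE; case: eqP => [->|_].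
have [q [Rpq le_q Rd]] := IH p le_p'.
exists q; split=> //.
  by move=> s; rewrite !ffunE; apply: leq_trans (le_q s) (leq_addl _ _).
have dE a (m m' : marking S) : msub m' m ->
    mdiff (madd (msing a) m) m' = madd (msing a) (mdiff m m').
  by move=> le; apply/ffunP=> s; rewrite !ffunE addnBA.
by rewrite !dE //; apply: add_closureD.
Qed.

End AdditiveClosure.

(** * Finite characterization of bisimulations *)

Section Simulation.
Variable N : pti_net.
Implicit Types (R : {set place N * place N}) (t : trans N).
Implicit Type m : marking (place N).

Definition respects_inh R t1 t2 : Prop :=
  forall s s', (s, s') \in R -> (s \in inh t1 <-> s' \in inh t2).

(** Clause (1) restricted to the markings [pre t1], which leaves finitely many cases. A transition
    inhibited by its own preset never fires, hence the condition [enabled t1 (pre t1)]. *)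
Definition place_simulation R : Prop :=
  forall t1 m2, enabled t1 (pre t1) -> add_closure R (pre t1) m2 ->
    exists t2, [/\ pre t2 = m2, add_closure R (post t1) (post t2),
                   lab t1 = lab t2 & respects_inh R t1 t2].

Lemma enabled_pre t m : enabled t m -> enabled t (pre t).
Proof.
case=> le_t dis; split=> //; apply/setP=> s; move/setP/(_ s): dis.
rewrite !inE; case: (_ \in inhibiting N) => //=.
by move/negbFE/eqP=> ms0; have := le_t s; rewrite ms0 leqn0 => /eqP ->.
Qed.

Lemma mdiffmm m : mdiff m m = theta.
Proof. by apply/ffunP=> s; rewrite !ffunE subnn. Qed.

(** Splitting along [pre t1] yields a part [q] of [m2] related to [pre t1]; the simulation provides
    a transition with preset exactly [q], and the remainders are related by the splitting. *)
Lemma simulation_fires R m1 m2 t1 m1' : place_simulation R ->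
  add_closure R m1 m2 -> fires m1 t1 m1' ->
  exists t2 m2', fires m2 t2 m2' /\ matching R m1 t1 m2 t2.
Proof.
move=> simR Rm [en1 _].
have [q [Rpq le_q Rd]] := add_closure_split Rm (proj1 en1).
have [t2 [t2q Rpost eq_l Rinh]] := simR _ _ (enabled_pre en1) Rpq.
subst q; exists t2, (madd (mdiff m2 (pre t2)) (post t2)); split; last by split.
(* A marked inhibitor place of [t2] would be related to a marked place of [m1], which by condition
   (b) would inhibit [t1]. *)
do 2![split=> //]; apply/setP=> s'; rewrite in_setI in_set0;
  apply/andP=> -[t2s' m2s'].
have [s m1s Rss'] := add_closure_dom Rm m2s'.
have t1s : s \in inh t1 by apply/(Rinh _ _ Rss').
by have /setP/(_ s) := proj2 en1; rewrite in_setI t1s m1s in_set0.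
Qed.

(** Firing [t1] at [pre t1] leaves the empty remainder, which is related to [theta] only. So the
    partner also empties [m2], and being enabled it has preset equal to [m2]. *)
Lemma fires_simulation R :
  (forall m1 m2 t1 m1', add_closure R m1 m2 -> fires m1 t1 m1' ->
     exists t2 m2', fires m2 t2 m2' /\ matching R m1 t1 m2 t2) ->
  place_simulation R.
Proof.
move=> simR t1 m2 en1 Rm.
have [t2 [_ [[[le2 _] _] [Rpre Rpost eq_l Rd Rinh]]]] :=
  simR _ _ _ _ Rm (conj en1 erefl).
exists t2; split=> //; move: Rd; rewrite mdiffmm => /add_closure_theta d0.
apply/ffunP=> s; move/ffunP/(_ s): d0; rewrite !ffunE => /eqP.
by rewrite subn_eq0 => ge2; apply/eqP; rewrite eqn_leq le2.
Qed.

Lemma matching_converse R m1 t1 m2 t2 :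
  matching R m1 t1 m2 t2 -> matching (converse R) m2 t2 m1 t1.
Proof.
case=> Rpre Rpost eq_l Rd Rinh; split=> //; try exact: add_closure_converse.
by move=> s s'; rewrite inE => /Rinh /= e; split=> /e.
Qed.

(** Clause (2) for [R] is clause (1) for its converse. *)
Lemma bisimulationP R : pti_place_bisimulation R <->
  place_simulation R /\ place_simulation (converse R).
Proof.
split=> [bisR|[simR simR'] m1 m2 Rm].
  split; apply: fires_simulation => m1 m2 t1 m1' Rm fire.
    exact: (proj1 (bisR _ _ Rm)) fire.
  have := add_closure_converse Rm; rewrite converseK => Rm'.
  have [t2 [m2' [fire2 mt]]] := proj2 (bisR _ _ Rm') _ _ fire.
  by exists t2, m2'; split=> //; apply: matching_converse.
split=> [t1 m1'|t2 m2'] fire; first exact: simulation_fires fire.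
have [t1 [m1' [fire1 /matching_converse]]] :=
  simulation_fires simR' (add_closure_converse Rm) fire.
by rewrite converseK => mt; exists t1, m1'.
Qed.

End Simulation.

(** * Closure properties of recursive functions *)

(* Only the values of [f] on sequences of length [n] matter; under a binder, the
   bound variable is [head 0 e] and the older ones are read from [behead e]. *)
Definition computable n (f : seq nat -> nat) : Prop :=
  exists p : recfun n, forall xs : n.-tuple nat, eval p xs (f xs).

Lemma computable_ext n f g : f =1 g -> computable n f -> computable n g.
Proof. by move=> fg [p pf]; exists p => xs; rewrite -fg. Qed.

Lemma computable_zero n : computable n (fun=> 0).
Proof. by exists (Zero n). Qed.

(** For a numeral [k] the arity [(k + n).+1] converts to an iterated successor, so that [var_tac]
    can recognize the variable by conversion. *)
Lemma computable_var k n :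
  computable (k + n).+1 (fun e => head 0 (iter k behead e)).
Proof.
have lt_k : k < (k + n).+1 by rewrite ltnS leq_addr.
exists (Proj (Ordinal lt_k)) => xs /=.
rewrite (tnth_nth 0) /=; elim: k xs {lt_k} => [|k IHk] xs /=.
  by rewrite nth0.
by have := IHk (behead_tuple xs); rewrite /= nth_behead -iterSr.
Qed.

(** On an explicit list [gs] the [foldr] reduces to a plain conjunction of computability
    hypotheses. *)
Lemma computable_comp k n f (gs : seq (seq nat -> nat)) :
  size gs = k -> computable k f ->
    foldr (fun g P => computable n g /\ P) True gs ->
  computable n (fun e => f [seq g e | g <- gs]).
Proof.
move=> <- [p pf] comp_gs.
have /fin_all_exists [q qP] (i : 'I_(size gs)) :
    exists q : recfun n, forall xs : n.-tuple nat,
      eval q xs (nth (fun=> 0) gs i xs).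
  case: i => i /= lt_i; elim: gs comp_gs i lt_i {p pf} =>
    // g gs IHgs [comp_g comp_gs].
  by case=> [|i] lt_i //; apply: IHgs.
exists (Comp p q) => xs /=.
have size_zs : size [seq g (tval xs) | g <- gs] == size gs by rewrite size_map.
exists (Tuple size_zs); split=> [i|]; last exact: (pf (Tuple size_zs)).
by rewrite (tnth_nth 0) /= (nth_map (fun=> 0)).
Qed.

Lemma computable_comp1 n f a : computable 1 (fun e => f (head 0 e)) ->
  computable n a -> computable n (fun e => f (a e)).
Proof. by move=> f_ ?; apply: (computable_comp (gs := [:: a]) _ f_). Qed.

Lemma computable_comp2 n f a b :
  computable 2 (fun e => f (head 0 e) (head 0 (behead e))) ->
  computable n a -> computable n b -> computable n (fun e => f (a e) (b e)).
Proof. by move=> f_ *; apply: (computable_comp (gs := [:: a; b]) _ f_). Qed.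

Lemma computable_comp4 n f a b c d :
  computable 4 (fun e => f (head 0 e) (head 0 (behead e))
                   (head 0 (behead (behead e)))
                   (head 0 (behead (behead (behead e))))) ->
  computable n a -> computable n b -> computable n c -> computable n d ->
  computable n (fun e => f (a e) (b e) (c e) (d e)).
Proof.
by move=> f_ *; apply: (computable_comp (gs := [:: a; b; c; d]) _ f_).
Qed.

Lemma computable_comp5 n f a b c d d' :
  computable 5 (fun e => f (head 0 e) (head 0 (behead e))
                   (head 0 (behead (behead e)))
                   (head 0 (behead (behead (behead e))))
                   (head 0 (behead (behead (behead (behead e)))))) ->
  computable n a -> computable n b -> computable n c -> computable n d ->
    computable n d' ->
  computable n (fun e => f (a e) (b e) (c e) (d e) (d' e)).
Proof.
by move=> f_ *; apply: (computable_comp (gs := [:: a; b; c; d; d']) _ f_).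
Qed.

Lemma computable_comp6 n f a b c d d' d'' :
  computable 6 (fun e => f (head 0 e) (head 0 (behead e))
                   (head 0 (behead (behead e)))
                   (head 0 (behead (behead (behead e))))
                   (head 0 (behead (behead (behead (behead e)))))
                   (head 0 (behead (behead (behead (behead (behead e))))))) ->
  computable n a -> computable n b -> computable n c -> computable n d ->
    computable n d' -> computable n d'' ->
  computable n (fun e => f (a e) (b e) (c e) (d e) (d' e) (d'' e)).
Proof.
by move=> f_ *; apply: (computable_comp (gs := [:: a; b; c; d; d'; d'']) _ f_).
Qed.

Lemma computable_succ n a : computable n a -> computable n (fun e => (a e).+1).
Proof.
apply: (computable_comp1 (f := S)); exists Succ => -[[|x []] //= i].
Qed.

Lemma computable_const n k : computable n (fun=> k).
Proof.
by elim: k => [|k];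
  [exact: computable_zero | exact: computable_succ].
Qed.

(** [PrimRec] recurses on a leading argument, so the number of rounds is first added in front of the
    parameters; composing with [b] and the [n] projections then removes it. *)
Lemma computable_iteri n b g a :
  computable n b -> computable n.+2 (fun e =>
    g (behead (behead e)) (head 0 e) (head 0 (behead e))) ->
  computable n a -> computable n (fun e => iteri (b e) (g e) (a e)).
Proof.
move=> comp_b [q qP] [p pP].
have comp_rec : computable n.+1 (fun e =>
  iteri (head 0 e) (g (behead e)) (a (behead e))).
  exists (PrimRec p q) => xs /=.
  have -> : head 0 xs = thead xs by case: xs => [[]].
  elim: (thead xs) => [|m IHm] /=; first exact: (pP (behead_tuple xs)).
  by exists (iteri m (g (behead xs)) (a (behead xs))); split=> //;
    apply: (qP [tuple of m :: _ :: _]).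
(* The last [k] projections: counting from the end lets the induction add one at the front while the
   positions stay absolute. *)
have comp_n : forall k, k <= n -> foldr (fun g P => computable n g /\ P) True
    [seq (fun e => nth 0 e i) | i <- iota (n - k) k].
  elim=> //= k IHk lt_kn; split; last first.
    by rewrite -subSn // subSS; apply: IHk; apply: ltnW.
  have lt_i : n - k.+1 < n by lia.
  by exists (Proj (Ordinal lt_i)) => xs /=; rewrite (tnth_nth 0).
have [] := computable_comp (k := n.+1) (n := n)
  (gs := b :: [seq (fun e => nth 0 e i) | i <- iota 0 n]) _ comp_rec.
- by rewrite /= size_map size_iota.
- by split=> //; have := comp_n n (leqnn n); rewrite subnn.
move=> r rP; exists r => xs; have := rP xs; rewrite /= -map_comp.
suff -> : [seq nth 0 xs i | i <- iota 0 n] = xs by [].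
by rewrite -[RHS](mkseq_nth 0) size_tuple.
Qed.

Ltac var_tac :=
  first [ exact: (computable_var 0 _) | exact: (computable_var 1 _) | exact:
    (computable_var 2 _)
        | exact: (computable_var 3 _) | exact: (computable_var 4 _) | exact:
          (computable_var 5 _)
        | exact: (computable_var 6 _) | exact: (computable_var 7 _) | exact:
          (computable_var 8 _) ].

Lemma computable_pred n a : computable n a -> computable n (fun e => (a e).-1).
Proof.
apply: (computable_comp1 (f := predn)).
apply: (@computable_ext _ (fun e => iteri (head 0 e) (fun i _ => i) 0)).
  by move=> e; case: (head 0 e).
by apply: computable_iteri; [var_tac | cbv beta;
  var_tac | exact: computable_zero].
Qed.

Lemma computable_add n a b : computable n a -> computable n b ->
  computable n (fun e => a e + b e).
Proof.
apply: (computable_comp2 (f := addn)).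
apply: (@computable_ext _ (fun e => iteri (head 0 e) (fun _ =>
  S) (head 0 (behead e)))).
  by move=> e; elim: (head 0 e) => //= m ->.
by apply: computable_iteri; [var_tac | cbv beta; apply: computable_succ;
  var_tac | var_tac].
Qed.

Lemma computable_sub n a b : computable n a -> computable n b ->
  computable n (fun e => a e - b e).
Proof.
apply: (computable_comp2 (f := subn)).
apply: (@computable_ext _ (fun e => iteri (head 0 (behead e)) (fun _ =>
  predn) (head 0 e))).
  move=> e; elim: (head 0 (behead e)) => [|m] /=; rewrite ?subn0 // => ->.
  by rewrite subnS.
by apply: computable_iteri; [var_tac | cbv beta; apply: computable_pred;
  var_tac | var_tac].
Qed.

Definition bsum b (g : nat -> nat) := \sum_(i <- iota 0 b) g i.
Definition ball b (p : pred nat) := all p (iota 0 b).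
Definition bex b (p : pred nat) := has p (iota 0 b).

Lemma bsumS b g : bsum b.+1 g = bsum b g + g b.
Proof. by rewrite /bsum -addn1 iotaD big_cat /= big_seq1 add0n. Qed.

(** Turns a number into the count of the indices below it; division, the 2-adic valuation and the
    length of a coded sequence become bounded sums in this way. *)
Lemma bsum_lt b k : bsum b (fun i => i < k) = minn b k.
Proof.
elim: b => [|b IHb]; first by rewrite /bsum big_nil min0n.
by rewrite bsumS IHb; lia.
Qed.

Lemma bexP b (p : pred nat) : reflect (exists2 i, i < b & p i) (bex b p).
Proof.
by apply: (iffP hasP) => -[i]; rewrite ?mem_iota; exists i; rewrite ?mem_iota.
Qed.

Lemma ballP b (p : pred nat) : reflect (forall i, i < b -> p i) (ball b p).
Proof.
by apply: (iffP allP) => bp i; have := bp i; rewrite mem_iota add0n.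
Qed.

Lemma computable_bsum n b g : computable n b ->
  computable n.+1 (fun e => g (behead e) (head 0 e)) ->
    computable n (fun e => bsum (b e) (g e)).
Proof.
move=> comp_b [p pg].
apply: (@computable_ext _ (fun e => iteri (b e) (fun i z => z + g e i) 0)).
  move=> e; elim: (b e) => [|m IHm] /=; first by rewrite /bsum big_nil.
  by rewrite IHm bsumS.
apply: computable_iteri => //; last exact: computable_zero.
apply: computable_add; first by var_tac.
(* The arguments are the index, the accumulator and the parameters; [h] skips the accumulator at
   position 1, which [g] does not take. *)
pose h j : 'I_n.+2 := if j is j'.+1 then inord j'.+2 else ord0.
exists (Comp p (fun j : 'I_n.+1 => Proj (h j))) => -[[|x [|z ps]] //= size_ps].
exists [tuple of x :: Tuple (n := n) (tval := ps) size_ps]; split;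
  last exact: pg.
case=> -[|j] lt_j; first by rewrite !(tnth_nth 0).
by rewrite !(tnth_nth 0) /= inordK.
Qed.

Lemma computable_mul n a b : computable n a -> computable n b ->
  computable n (fun e => a e * b e).
Proof.
apply: (computable_comp2 (f := muln)).
apply: (@computable_ext _ (fun e => bsum (head 0 e) (fun _ =>
  head 0 (behead e)))).
  by move=> e; rewrite /bsum big_const_seq count_predT size_iota iter_addn_0
    mulnC.
by apply: computable_bsum; var_tac.
Qed.

Lemma computable_exp n a b : computable n a -> computable n b ->
  computable n (fun e => a e ^ b e).
Proof.
apply: (computable_comp2 (f := expn)).
apply: (@computable_ext _ (fun e => iteri (head 0 (behead e))
  (fun _ z => head 0 e * z) 1)).
  by move=> e; elim: (head 0 (behead e)) => //= m ->; rewrite expnS.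
apply: computable_iteri; [var_tac | cbv beta; apply: computable_mul;
  var_tac | exact: computable_const].
Qed.

Lemma computable_leq n a b : computable n a -> computable n b ->
  computable n (fun e => (a e <= b e : nat)).
Proof.
move=> comp_a comp_b; apply: (@computable_ext _ (fun e => 1 - (a e - b e))).
  by move=> e; case: leqP; lia.
by apply: computable_sub; [exact: computable_const | exact: computable_sub].
Qed.

Lemma computable_and n (p q : seq nat -> bool) :
  computable n (fun e => p e) -> computable n (fun e => q e) ->
    computable n (fun e => p e && q e).
Proof.
move=> comp_p comp_q; apply: (@computable_ext _ (fun e => p e * q e)).
  by move=> e; rewrite mulnb.
exact: computable_mul.
Qed.

Lemma computable_neg n (p : seq nat -> bool) :
  computable n (fun e => p e) -> computable n (fun e => ~~ p e).
Proof.
move=> comp_p; apply: (@computable_ext _ (fun e => 1 - p e));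
  first by move=> e; case: (p e).
by apply: computable_sub => //; exact: computable_const.
Qed.

Lemma computable_imp n (p q : seq nat -> bool) :
  computable n (fun e => p e) -> computable n (fun e => q e) ->
    computable n (fun e => p e ==> q e).
Proof.
move=> comp_p comp_q; apply: (@computable_ext _ (fun e => ~~ (p e && ~~ q e))).
  by move=> e; case: (p e); case: (q e).
by apply: computable_neg; apply: computable_and => //; apply: computable_neg.
Qed.

Lemma computable_eq n (a b : seq nat -> nat) :
  computable n a -> computable n b -> computable n (fun e => a e == b e).
Proof.
move=> comp_a comp_b; apply: (@computable_ext _ (fun e =>
  (a e <= b e) && (b e <= a e))).
  by move=> e; rewrite eqn_leq.
by apply: computable_and; apply: computable_leq.
Qed.

Lemma computable_eqb n (p q : seq nat -> bool) :
  computable n (fun e => p e) -> computable n (fun e => q e) ->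
    computable n (fun e => p e == q e).
Proof.
move=> comp_p comp_q; apply: (@computable_ext _ (fun e => (p e : nat) == q e)).
  by move=> e; case: (p e); case: (q e).
exact: computable_eq.
Qed.

Lemma computable_bex n b (p : seq nat -> pred nat) : computable n b ->
  computable n.+1 (fun e => p (behead e) (head 0 e)) ->
    computable n (fun e => bex (b e) (p e)).
Proof.
move=> comp_b comp_p; apply: (@computable_ext _ (fun e =>
  0 < bsum (b e) (p e))).
  move=> e; rewrite /bsum /bex has_count -sum1_count [in RHS]big_mkcond /=.
  congr (nat_of_bool (_ < _)); apply: eq_bigr => i _; by case: (p e i).
by apply: computable_leq; [exact: computable_const | exact: (computable_bsum
  (g := fun e i => p e i))].
Qed.

Lemma computable_ball n b (p : seq nat -> pred nat) : computable n b ->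
  computable n.+1 (fun e => p (behead e) (head 0 e)) ->
    computable n (fun e => ball (b e) (p e)).
Proof.
move=> comp_b comp_p; apply: (@computable_ext _ (fun e =>
  ~~ bex (b e) (fun i => ~~ p e i))).
  by move=> e; rewrite /bex has_predC negbK.
by apply: computable_neg; apply: computable_bex => //;
  apply: (computable_neg (p := fun e => p (behead e) (head 0 e))).
Qed.

Lemma computable_div n a b : computable n a -> computable n b ->
  computable n (fun e => a e %/ b e).
Proof.
apply: (computable_comp2 (f := divn)).
(* The quotient of [m] by [d] counts the [k < m] with [k.+1 * d <= m]. For [d = 0] every [k] would
   count, so the first factor forces the value 0. *)
apply: (@computable_ext _ (fun e => (0 < head 0 (behead e)) * bsum (head 0 e)
   (fun k => k.+1 * head 0 (behead e) <= head 0 e))).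
  move=> e; move: (head 0 e) (head 0 (behead e)) => m [|d].
    by rewrite divn0 mul0n.
  rewrite mul1n -[RHS](minn_idPr (leq_div m d.+1)) -bsum_lt.
  by apply: eq_bigr => i _; rewrite leq_divRL.
apply: computable_mul; first by apply: computable_leq;
  [exact: computable_const | var_tac].
apply: computable_bsum; first by var_tac.
by apply: computable_leq; [apply: computable_mul; [apply: computable_succ|]|];
  var_tac.
Qed.

Lemma computable_logn2 n a : computable n a ->
  computable n (fun e => logn 2 (a e)).
Proof.
apply: (computable_comp1 (f := logn 2)).
(* The valuation of [a] counts the [k < a] such that [2 ^ k.+1] divides [a]; for [a = 0] the empty
   sum agrees with [logn 2 0 = 0]. *)
apply: (@computable_ext _ (fun e => bsum (head 0 e) (fun k =>
  head 0 e %/ 2 ^ k.+1 * 2 ^ k.+1 == head 0 e))).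
  move=> e; case: (head 0 e) => [|m]; first by rewrite /bsum big_nil.
  have /ltnW/minn_idPr <- := ltn_logl 2 (ltn0Sn m).
  by rewrite -bsum_lt; apply: eq_bigr => i _; rewrite -dvdn_eq pfactor_dvdn.
apply: computable_bsum; first by var_tac.
have comp_2 : computable 2 (fun e => 2 ^ (head 0 e).+1).
  by apply: computable_exp; [exact: computable_const | apply: computable_succ;
    var_tac].
apply: computable_eq; last by var_tac.
by apply: computable_mul => //; apply: computable_div => //; var_tac.
Qed.

(** * Arithmetic of sequence codes *)

Definition code_tail x := x %/ 2 ^ (logn 2 x).+1.

Lemma code_cons n s :
  CodeSeq.code (n :: s) = 2 ^ n * (CodeSeq.code s).*2.+1.
Proof. by []. Qed.

Lemma logn2_code_cons n s : logn 2 (CodeSeq.code (n :: s)) = n.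
Proof.
rewrite code_cons lognM ?expn_gt0 // pfactorK //.
by rewrite logn_coprime ?addn0 // coprime2n /= odd_double.
Qed.

(** Dividing [2 ^ n * (2 * code s + 1)] by [2 ^ n.+1] rounds away the odd term. *)
Lemma code_tail_cons n s : code_tail (CodeSeq.code (n :: s)) = CodeSeq.code s.
Proof.
rewrite /code_tail logn2_code_cons code_cons expnSr divnMA mulKn ?expn_gt0 //.
by rewrite divn2 /= uphalf_double.
Qed.

Lemma iter_code_tail i s : iter i code_tail (CodeSeq.code s) = CodeSeq.code
  (drop i s).
Proof.
elim: i s => [|i IHi] s; first by rewrite drop0.
rewrite iterSr; case: s => [|n s]; last by rewrite code_tail_cons IHi.
(* The code 0 of the empty sequence is a fixed point of [code_tail]. *)
by rewrite -[code_tail _]/(CodeSeq.code [::]) IHi.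
Qed.

Lemma code_eq0 s : (CodeSeq.code s == 0) = nilp s.
Proof. by case: s => // n s; rewrite code_cons muln_eq0 expn_eq0. Qed.

Lemma code_size s : size s <= CodeSeq.code s.
Proof.
elim: s => // n s IHs; rewrite code_cons /=.
apply: leq_trans (leq_pmull _ _); first by rewrite ltnS -addnn; lia.
by rewrite expn_gt0.
Qed.

(** Applied along the nesting of codes, this places the numbers occurring in an instance below the
    code of the instance. *)
Lemma code_mem x s : x \in s -> x < CodeSeq.code s.
Proof.
elim: s => // n s IHs; rewrite code_cons inE => /predU1P [->|/IHs lt_x].
  by apply: leq_trans (leq_pmulr _ _); first exact: ltn_expl.
apply: leq_trans (leq_pmull _ _); first by rewrite -addnn; lia.
by rewrite expn_gt0.
Qed.

(** Prepending [n] multiplies by [2 ^ n] and, through [2 * code s + 1], by about one more factor 2;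
    an entry at most [K] thus costs at most [K.+1] in the exponent. *)
Lemma code_ltn K s : {in s, forall x, x <= K} ->
  CodeSeq.code s < 2 ^ (size s * K.+1).
Proof.
elim: s => // n s IHs leK; rewrite code_cons mulSn.
have le_n := leK n (mem_head n s).
have /IHs lt_s : {in s, forall x, x <= K} by move=> x sx; apply: leK;
  rewrite inE sx orbT.
rewrite expnD; apply: leq_trans (_ : 2 ^ n * 2 ^ (size s * K.+1).+1 <= _).
  by rewrite ltn_mul2l expn_gt0 /= expnS mul2n ltn_Sdouble.
by rewrite expnS mulnA -expnSr leq_mul2r leq_exp2l // ltnS le_n orbT.
Qed.

(** Decoding gives convenient equations and the default 0 past the end; [entryE] and [lenE] supply
    the arithmetic forms from which computability follows. *)
Definition entry x i := nth 0 (CodeSeq.decode x) i.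
Definition entry2 x i j := entry (entry x i) j.
Definition len x := size (CodeSeq.decode x).

Lemma entry_code s i : entry (CodeSeq.code s) i = nth 0 s i.
Proof. by rewrite /entry CodeSeq.codeK. Qed.

Lemma entryE x i : entry x i = logn 2 (iter i code_tail x).
Proof.
rewrite -[x in RHS]CodeSeq.decodeK iter_code_tail /entry -[i in LHS]addn0
  -nth_drop.
by case: (drop i _) => [|n s] //; rewrite logn2_code_cons.
Qed.

Lemma lenE x : len x = bsum x (fun i => iter i code_tail x != 0).
Proof.
have /minn_idPr <- : len x <= x by rewrite -[x in _ <= x]CodeSeq.decodeK
  code_size.
rewrite -bsum_lt; apply: eq_bigr => i _.
by rewrite -{2}[x]CodeSeq.decodeK iter_code_tail code_eq0 /nilp size_drop
  subn_eq0 -ltnNge.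
Qed.

Lemma computable_iter_code_tail n a b : computable n a -> computable n b ->
  computable n (fun e => iter (a e) code_tail (b e)).
Proof.
apply: (computable_comp2 (f := fun i => iter i code_tail)).
apply: (@computable_ext _ (fun e => iteri (head 0 e) (fun _ =>
  code_tail) (head 0 (behead e)))).
  by move=> e; elim: (head 0 e) => //= m ->.
apply: computable_iteri; [var_tac | | var_tac]; cbv beta.
apply: computable_div; first by var_tac.
by apply: computable_exp; [exact: computable_const | apply: computable_succ;
  apply: computable_logn2; var_tac].
Qed.

Lemma computable_entry n a b : computable n a -> computable n b ->
  computable n (fun e => entry (a e) (b e)).
Proof.
move=> comp_a comp_b; apply: (@computable_ext _ (fun e =>
  logn 2 (iter (b e) code_tail (a e)))).
  by move=> e; rewrite entryE.
by apply: computable_logn2; apply: computable_iter_code_tail.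
Qed.

Lemma computable_len n a : computable n a -> computable n (fun e => len (a e)).
Proof.
apply: (computable_comp1 (f := len)).
apply: (@computable_ext _ (fun e => bsum (head 0 e) (fun i =>
  iter i code_tail (head 0 e) != 0))).
  by move=> e; rewrite lenE.
apply: computable_bsum; first by var_tac.
by apply: computable_neg; apply: computable_eq;
  [apply: computable_iter_code_tail; var_tac | exact: computable_const].
Qed.

(** * The decision procedure *)

(* [n] is the number of places, [B] bounds the quantifiers over codes and [T]
   codes the list of transitions, whose entries 0 to 3 are the preset, the label,
   the postset and the inhibitor set.  A relation or a matrix is the code of the
   sequence of the codes of its rows. *)
Definition planb n B r x y : bool :=
  bex B (fun w =>
    [&& ball n (fun s => ball n (fun s' =>
          (entry2 w s s' != 0) ==> (entry2 r s s' != 0))),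
        ball n (fun s => bsum n (fun s' => entry2 w s s') == entry x s) &
        ball n (fun s' => bsum n (fun s => entry2 w s s') == entry y s')]).

Definition respectsb n r u v : bool :=
  ball n (fun s => ball n (fun s' =>
    (entry2 r s s' != 0) ==> ((entry u s != 0) == (entry v s' != 0)))).

Definition converseb n r r' : bool :=
  ball n (fun s => ball n (fun s' =>
    (entry2 r s s' != 0) == (entry2 r' s' s != 0))).

Definition matchb n B r y t u : bool :=
  [&& ball n (fun s => entry2 u 0 s == entry y s),
      planb n B r (entry t 2) (entry u 2),
      entry t 1 == entry u 1 & respectsb n r (entry t 3) (entry u 3)].

(** [y] ranges over codes of candidate partner presets. The first guard expresses that the
    transition is enabled at its own preset. *)
Definition simb n B T r : bool :=
  ball (len T) (fun i => ball B (fun y =>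
    (ball n (fun s => (entry2 (entry T i) 3 s != 0) ==> (entry2 (entry T i) 0
      s == 0)) &&
     planb n B r (entry2 T i 0) y) ==>
    bex (len T) (fun j => matchb n B r y (entry T i) (entry T j)))).

(** The converse of [r] is guessed as [r'] and then checked, so that [simb] serves both
    directions. *)
Definition bisimb n B T x y : bool :=
  bex B (fun r => bex B (fun r' =>
    [&& converseb n r r', planb n B r x y, simb n B T r & simb n B T r'])).

(* Bounds the code of a [c] x [c] matrix with entries at most [c * c]: the inner
   power bounds the codes of its rows. *)
Definition code_bound c := 2 ^ (c * (2 ^ (c * (c * c).+1)).+1).

(** Mirrors [code_instance]: entry 0 is the net, with the number of places and the list of
    transitions at positions 0 and 2; entries 1 and 2 are the markings. *)
Definition decide c : bool :=
  bisimb (entry2 c 0 0) (code_bound c) (entry2 c 0 2) (entry c 1) (entry c 2).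

(** * Computability of the decision procedure *)

Ltac computable_step :=
  lazymatch goal with
  | |- computable _ (fun e => nat_of_bool (_ && _)) => apply: computable_and
  | |- computable _ (fun e => nat_of_bool (_ ==> _)) => apply: computable_imp
  | |- computable _ (fun e => nat_of_bool (~~ _)) => apply: computable_neg
  | |- computable _ (fun e => nat_of_bool (_ == _)) =>
    first [apply: computable_eqb | apply: computable_eq]
  | |- computable _ (fun e => nat_of_bool (ball _ _)) => apply: computable_ball
  | |- computable _ (fun e => nat_of_bool (bex _ _)) => apply: computable_bex
  | |- computable _ (fun e => bsum _ _) => apply: computable_bsum
  | |- computable _ (fun e => entry2 _ _ _) => rewrite /entry2
  | |- computable _ (fun e => entry _ _) => apply: computable_entry
  | |- computable _ (fun e => len _) => apply: computable_len
  | |- computable _ (fun e => _ * _) => apply: computable_mul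
  | |- computable _ (fun e => _ ^ _) => apply: computable_exp
  | |- computable _ (fun e => (_).+1) =>
    first [exact: computable_const | apply: computable_succ]
  | |- computable _ (fun e => 0) => exact: computable_const
  end; cbv beta.
Ltac computable_tac := repeat first [var_tac | computable_step].

Lemma computable_planb n a b c d f : computable n a -> computable n b ->
  computable n c -> computable n d -> computable n f ->
  computable n (fun e => planb (a e) (b e) (c e) (d e) (f e)).
Proof.
apply: (computable_comp5 (f := planb)); rewrite /planb;
  computable_tac.
Qed.

Lemma computable_respectsb n a b c d : computable n a -> computable n b ->
  computable n c -> computable n d ->
  computable n (fun e => respectsb (a e) (b e) (c e) (d e)).
Proof.
apply: (computable_comp4 (f := respectsb)); rewrite /respectsb;
  computable_tac.
Qed.

Lemma computable_matchb n a b c d f g :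
  computable n a -> computable n b -> computable n c -> computable n d ->
    computable n f -> computable n g ->
  computable n (fun e => matchb (a e) (b e) (c e) (d e) (f e) (g e)).
Proof.
apply: (computable_comp6 (f := matchb)); rewrite /matchb; computable_tac.
- by apply: computable_planb; computable_tac.
- by apply: computable_respectsb; computable_tac.
Qed.

Lemma computable_simb n a b c d : computable n a -> computable n b ->
  computable n c -> computable n d ->
  computable n (fun e => simb (a e) (b e) (c e) (d e)).
Proof.
apply: (computable_comp4 (f := simb)); rewrite /simb; computable_tac.
- by apply: computable_planb; computable_tac.
- by apply: computable_matchb; computable_tac.
Qed.

Lemma computable_bisimb n a b c d f : computable n a -> computable n b ->
  computable n c -> computable n d -> computable n f ->
  computable n (fun e => bisimb (a e) (b e) (c e) (d e) (f e)).
Proof.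
apply: (computable_comp5 (f := bisimb)); rewrite /bisimb /converseb;
  computable_tac.
- by apply: computable_planb; computable_tac.
- by apply: computable_simb; computable_tac.
- by apply: computable_simb; computable_tac.
Qed.

Lemma computable_decide : computable 1 (fun e => decide (head 0 e)).
Proof.
by rewrite /decide /code_bound; apply: computable_bisimb;
  computable_tac.
Qed.

(** * Listings of finite types *)

Lemma nth_map_index (T : eqType) (U : Type) x0 (f : T -> U) s x :
  x \in s -> nth x0 (map f s) (index x s) = f x.
Proof. by move=> sx; rewrite (nth_map x) ?index_mem // nth_index. Qed.

Section Enumeration.
Variables (T : finType) (e : seq T).
Hypothesis eT : Finite.axiom e.

Lemma mem_axiom x : x \in e.
Proof. by rewrite -has_pred1 has_count eT. Qed.

Lemma uniq_axiom : uniq e.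
Proof. by apply: count_mem_uniq => x; rewrite eT mem_axiom. Qed.

(** Positions in a listing run exactly once through an initial segment, so sums and quantifiers over
    the type become bounded ones over positions. *)
Lemma map_index_axiom : [seq index x e | x <- e] = iota 0 (size e).
Proof.
apply: (@eq_from_nth _ 0) => [|i]; rewrite size_map ?size_iota // => lt_i.
case: e lt_i uniq_axiom => // x0 e' lt_i ue.
by rewrite (nth_map x0) // nth_iota // index_uniq.
Qed.

Lemma ball_axiomP (p : pred nat) :
  reflect (forall x, p (index x e)) (ball (size e) p).
Proof.
rewrite /ball -map_index_axiom all_map.
by apply: (iffP allP) => pe x; [apply: pe (mem_axiom x) | move=> _; apply: pe].
Qed.

Lemma bex_axiomP (p : pred nat) :
  reflect (exists x, p (index x e)) (bex (size e) p).
Proof.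
rewrite /bex -map_index_axiom has_map.
apply: (iffP hasP) => [[x _ px]|[x px]]; first by exists x.
by exists x; rewrite ?mem_axiom.
Qed.

Lemma bsum_axiom f : bsum (size e) f = \sum_x f (index x e).
Proof.
rewrite /bsum -map_index_axiom big_map; apply: perm_big.
apply: uniq_perm; rewrite ?uniq_axiom ?index_enum_uniq // => x.
by rewrite mem_axiom mem_index_enum.
Qed.

End Enumeration.

(** * Correctness of the decision procedure on coded instances *)

Section Correctness.
Variables (N : pti_net) (eS : seq (place N)) (eA : seq (label N)).
Variable eT : seq (trans N).
Hypotheses (eSP : Finite.axiom eS) (eAP : Finite.axiom eA).
Hypothesis eTP : Finite.axiom eT.
Variable c : nat.
Hypothesis size_eS : size eS <= c.
Hypothesis marking_le : forall (t : trans N) s, pre t s <= c /\ post t s <= c.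

Local Notation n := (size eS).
Local Notation rk s := (index s eS).
Local Notation B := (code_bound c).
Local Notation tc := (CodeSeq.code [seq code_trans eS eA t | t <- eT]).
Implicit Types (m : marking (place N)) (R : {set place N * place N}).

(** Every number denotes a marking, and likewise a relation through [rel_of], so the bounded
    quantifiers may range over all numbers without a test for well-formed codes. *)
Definition marking_of x : marking (place N) := [ffun s => entry x (rk s)].
Definition rel_of r : {set place N * place N} :=
  [set p | entry2 r (rk p.1) (rk p.2) != 0].

Lemma code_markingK m : marking_of (code_marking eS m) = m.
Proof.
by apply/ffunP=> s;
  rewrite ffunE entry_code nth_map_index // mem_axiom.
Qed.

Definition code_matrix (W : place N -> place N -> nat) : nat :=
  CodeSeq.code [seq CodeSeq.code [seq W s s' | s' <- eS] | s <- eS].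

Lemma code_matrixE W s s' : entry2 (code_matrix W) (rk s) (rk s') = W s s'.
Proof. by rewrite /entry2 !(entry_code, nth_map_index) // mem_axiom. Qed.

Lemma row_bound (f : place N -> nat) : (forall s, f s <= c * c) ->
  CodeSeq.code [seq f s | s <- eS] < 2 ^ (c * (c * c).+1).
Proof.
move=> le_f; apply: leq_trans (_ : 2 ^ (n * (c * c).+1) <= _).
  rewrite -[n](size_map f); apply: code_ltn => x /mapP [s _ ->]; exact: le_f.
by rewrite leq_exp2l // leq_mul2r size_eS orbT.
Qed.

(** A marking is coded like one row of a matrix, and the bound for matrices dominates the one for
    rows; for [c = 0] both exponents vanish. *)
Lemma code_marking_bound m : (forall s, m s <= c * c) -> code_marking eS m < B.
Proof.
move=> le_m; apply: leq_trans (row_bound le_m) _.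
rewrite leq_exp2l // leq_mul2l ltnS; case: eqVneq => //= c_neq0.
apply: leq_trans (ltnW (ltn_expl _ (ltnSn 1))) _.
by rewrite leq_exp2l // (leq_trans (leqnSn _)) // leq_pmull // lt0n.
Qed.

Lemma code_matrix_bound W : (forall s s', W s s' <= c * c) -> code_matrix W < B.
Proof.
move=> le_W; apply: leq_trans (_ : 2 ^ (n * (2 ^ (c * (c * c).+1)).+1) <= _).
  rewrite /code_matrix; set r := map _ eS.
  have -> : n = size r by rewrite size_map.
  by apply: code_ltn => x /mapP [s _ ->]; apply/ltnW/row_bound.
by rewrite leq_exp2l // leq_mul2r size_eS orbT.
Qed.

(** From right to left, an entry of a plan is at most its row sum, a token count of the first
    marking, so the code of the plan lies below the bound. *)
Lemma planbP r x y : (forall s, marking_of x s <= c * c) ->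
  planb n B r x y <-> add_closure (rel_of r) (marking_of x) (marking_of y).
Proof.
move=> le_x; split=> [/bexP [w _ /and3P [/(ball_axiomP eSP) supp]]|].
  move=> /(ball_axiomP eSP) row /(ball_axiomP eSP) col.
  apply: (@plan_add_closure _ _ _ _ (fun s s' => entry2 w (rk s) (rk s')));
    split.
  - move=> s s' Wn0; rewrite inE /=.
    by have /(ball_axiomP eSP)/(_ s')/implyP := supp s; apply.
  - by move=> s; have /eqP := row s; rewrite (bsum_axiom eSP) ffunE.
  - by move=> s'; have /eqP := col s'; rewrite (bsum_axiom eSP) ffunE.
case/add_closure_plan=> W [supp row col]; apply/bexP; exists (code_matrix W).
  apply: code_matrix_bound => s s'; apply: leq_trans (le_x s).
  by rewrite -row (bigD1 s') //= leq_addr.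
apply/and3P; split; apply/(ball_axiomP eSP) => s.
- apply/(ball_axiomP eSP) => s'; rewrite code_matrixE; apply/implyP=> /supp.
  by rewrite inE.
- rewrite (bsum_axiom eSP); have := row s; rewrite ffunE => <-.
  by apply/eqP/eq_bigr => s' _; rewrite code_matrixE.
- rewrite (bsum_axiom eSP); have := col s; rewrite ffunE => <-.
  by apply/eqP/eq_bigr => s' _; rewrite code_matrixE.
Qed.

Lemma entry_tc t : entry tc (index t eT) = code_trans eS eA t.
Proof. by rewrite entry_code nth_map_index // mem_axiom. Qed.

Lemma len_tc : len tc = size eT.
Proof. by rewrite /len CodeSeq.codeK size_map. Qed.

Lemma entry_places X s : (entry (code_places eS X) (rk s) != 0) = (s \in X).
Proof. by rewrite entry_code nth_map_index ?mem_axiom //; case: (s \in X). Qed.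

Lemma entry_marking m s : entry (code_marking eS m) (rk s) = m s.
Proof. by rewrite entry_code nth_map_index // mem_axiom. Qed.

Lemma respectsbP r t u :
  respectsb n r (code_places eS (inh t)) (code_places eS (inh u)) <->
  respects_inh (rel_of r) t u.
Proof.
split=> [/(ball_axiomP eSP) H s s'|H].
  rewrite inE /= => rss'; have /(ball_axiomP eSP)/(_ s') := H s.
  by rewrite rss' /= !entry_places => /eqP ->.
apply/(ball_axiomP eSP)=> s; apply/(ball_axiomP eSP)=> s'.
apply/implyP=> rss'; rewrite !entry_places.
have Rss' : (s, s') \in rel_of r by rewrite inE.
by apply/eqP; apply/idP/idP => /(H _ _ Rss').
Qed.

Lemma selfbP t :
  ball n (fun s => (entry2 (code_trans eS eA t) 3 s != 0) ==>
                   (entry2 (code_trans eS eA t) 0 s == 0)) <->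
  enabled t (pre t).
Proof.
rewrite /entry2 /code_trans !entry_code /=;
  split=> [/(ball_axiomP eSP) H|[_ /setP H]].
  split=> //; apply/setP=> s; rewrite in_setI in_set0; have := H s.
  rewrite entry_places entry_marking [s \in mdom _]inE.
  by case: (s \in inh t) => //= /eqP ->.
apply/(ball_axiomP eSP)=> s; rewrite entry_places entry_marking; have := H s.
by rewrite in_setI in_set0 [s \in mdom _]inE;
  case: (s \in inh t) => //= /negbFE.
Qed.

Lemma le_sqr : c <= c * c.
Proof. by case: (c) => // k; rewrite leq_pmulr. Qed.

Lemma matchbP r y t u :
  matchb n B r y (code_trans eS eA t) (code_trans eS eA u) <->
  [/\ pre u = marking_of y, add_closure (rel_of r) (post t) (post u),
      lab t = lab u & respects_inh (rel_of r) t u].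
Proof.
rewrite /matchb /entry2 /code_trans !entry_code /=.
have plP : planb n B r (code_marking eS (post t)) (code_marking eS (post u)) <->
    add_closure (rel_of r) (post t) (post u).
  rewrite planbP ?code_markingK // => s.
  by apply: leq_trans le_sqr; case: (marking_le t s).
split=> [/and4P [/(ball_axiomP eSP) eq_y /plP Rpost /eqP eq_l /respectsbP
  Rinh]|].
  split=> //.
    by apply/ffunP=> s; rewrite ffunE; have /eqP := eq_y s;
      rewrite entry_marking.
  (* Labels are compared by their positions in [eA], which determine them. *)
  by rewrite -(nth_index (lab t) (mem_axiom eAP (lab t))) eq_l nth_index //
    mem_axiom.
case=> eq_y /plP Rpost eq_l /respectsbP Rinh; apply/and4P; split=> //.
  by apply/(ball_axiomP eSP)=> s; rewrite entry_marking eq_y ffunE.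
by rewrite eq_l.
Qed.

Lemma simbP r : simb n B tc r <-> place_simulation (rel_of r).
Proof.
have le_pre t s : marking_of (code_marking eS (pre t)) s <= c * c.
  by rewrite code_markingK; apply: leq_trans le_sqr; case: (marking_le t s).
have tcE t : entry2 tc (index t eT) 0 = code_marking eS (pre t).
  by rewrite /entry2 entry_tc entry_code.
rewrite /simb len_tc; split=> [/(ball_axiomP eTP) H t1 m2 en1 Rm|H].
  (* An entry of [m2] is at most the size of [pre t1]: at most [c] tokens on each of at most [c]
     places. This is the origin of the bound [c * c]. *)
  have lt_m2 : code_marking eS m2 < B.
    apply: code_marking_bound => s;
      apply: leq_trans (add_closure_le_sum s Rm) _.
    apply: leq_trans (_ : \sum_(s' : place N) c <= _).
      by apply: leq_sum => s' _; case: (marking_le t1 s').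
    rewrite sum_nat_const leq_mul2r (leq_trans _ size_eS) ?orbT //.
    by rewrite cardE uniq_leq_size ?enum_uniq // => s' _; apply: mem_axiom.
  have /ballP/(_ _ lt_m2)/implyP := H t1.
  rewrite entry_tc tcE => simt1.
  have /(bex_axiomP eTP) [t2] : bex (size eT) (fun j => matchb n B r
      (code_marking eS m2) (code_trans eS eA t1) (entry tc j)).
    apply: simt1; apply/andP; split; first exact/selfbP.
    by apply/planbP => //; rewrite !code_markingK.
  by rewrite entry_tc => /matchbP; rewrite code_markingK; exists t2.
apply/(ball_axiomP eTP)=> t1; apply/ballP=> y _.
rewrite entry_tc tcE; apply/implyP=> /andP [/selfbP en1
  /(planbP _ _ (le_pre t1))].
rewrite code_markingK => Rm; have [t2 /matchbP mt] := H _ _ en1 Rm.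
by apply/(bex_axiomP eTP); exists t2; rewrite entry_tc.
Qed.

Lemma bisimbP m1 m2 : (forall s, m1 s <= c) ->
  bisimb n B tc (code_marking eS m1) (code_marking eS m2) <->
  pti_place_bisimilar m1 m2.
Proof.
move=> le_m1.
have plP r : planb n B r (code_marking eS m1) (code_marking eS m2) <->
    add_closure (rel_of r) m1 m2.
  by rewrite planbP ?code_markingK // => s; apply: leq_trans le_sqr.
have convP r r' : converseb n r r' <-> rel_of r' = converse (rel_of r).
  split=> [/(ball_axiomP eSP) H|/setP H].
    apply/setP=> -[s' s]; rewrite !inE /=.
    by have /(ball_axiomP eSP)/(_ s')/eqP -> := H s.
  apply/(ball_axiomP eSP)=> s; apply/(ball_axiomP eSP)=> s'.
  by have := H (s', s); rewrite !inE /= => ->.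
split=> [/bexP [r _ /bexP [r' _ /and4P [/convP cr /plP Rm /simbP sr /simbP
  sr']]]|].
  by exists (rel_of r); split=> //; apply/bisimulationP; rewrite -cr.
case=> R [/bisimulationP [sR sR'] Rm].
(* The 0-1 matrix of a relation needs [1 <= c * c], which holds as soon as there is a place. *)
have c_gt0 (s : place N) : 0 < c * c.
  rewrite muln_gt0 andbb; apply: leq_trans size_eS.
  by rewrite -has_predT; apply/hasP; exists s => //; apply: mem_axiom.
have code_rel (R' : {set place N * place N}) : exists2 r, r < B & rel_of r = R'.
  exists (code_matrix (fun s s' => (s, s') \in R')).
    apply: code_matrix_bound => s s'; exact: leq_trans (leq_b1 _) (c_gt0 s).
  by apply/setP=> -[s s']; rewrite inE code_matrixE /=; case: (_ \in R').
have [r lt_r rE] := code_rel R; have [r' lt_r' rE'] := code_rel (converse R).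
apply/bexP; exists r => //; apply/bexP; exists r' => //; apply/and4P; split.
- by apply/convP; rewrite rE rE'.
- by apply/plP; rewrite rE.
- by apply/simbP; rewrite rE.
- by apply/simbP; rewrite rE'.
Qed.

End Correctness.

(** The bound [c] of the correctness section is instantiated with the instance code itself, which
    dominates the number of places and all token counts by repeated use of [code_mem]. *)
Lemma decideP (N : pti_net) (m1 m2 : marking (place N)) c :
  instance_code m1 m2 c -> decide c <-> pti_place_bisimilar m1 m2.
Proof.
case=> eS [eA [eT [eSP eAP eTP ->]]]; set c0 := code_instance _ _ _ _ _.
have lt_net : code_net eS eA eT < c0 by apply: code_mem; rewrite inE eqxx.
have lt_m1 : code_marking eS m1 < c0 by apply: code_mem; rewrite !inE eqxx orbT.
have le_S : size eS <= c0.
  apply: ltnW; apply: ltn_trans lt_net; by apply: code_mem; rewrite inE eqxx.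
have le_marking (m : marking (place N)) s : m s <= code_marking eS m.
  by apply/ltnW/code_mem/map_f/mem_axiom.
have le_T (t : trans N) s : pre t s <= c0 /\ post t s <= c0.
  have lt_t : code_trans eS eA t < c0.
    apply: ltn_trans lt_net; rewrite /code_net.
    set T := CodeSeq.code (map _ eT).
    apply: ltn_trans (_ : T < _); first by apply/code_mem/map_f/mem_axiom.
    by apply: code_mem; rewrite !inE eqxx !orbT.
  by split; apply: leq_trans (le_marking _ s) _; apply/ltnW;
     apply: ltn_trans lt_t; apply: code_mem; rewrite !inE eqxx ?orbT.
have c0E i : entry c0 i =
    nth 0 [:: code_net eS eA eT; code_marking eS m1; code_marking eS m2] i.
  exact: entry_code.
rewrite /decide /entry2 !c0E /= /code_net !entry_code /=.
by apply: bisimbP => // s; apply: leq_trans (le_marking _ s) (ltnW lt_m1).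
Qed.

Theorem theorem30 :
  exists p : recfun 1,
    forall (N : pti_net) (m1 m2 : marking (place N)) (c : nat),
      instance_code m1 m2 c ->
      exists b : bool,
        eval p [tuple c] (nat_of_bool b) /\
        (b = true <-> pti_place_bisimilar m1 m2).
Proof.
have [p pP] := computable_decide; exists p => N m1 m2 c cP.
by exists (decide c); split; [exact: (pP [tuple c]) | exact: decideP].
Qed.
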